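(* Let $k$ be a field and let $\mathcal A$ be a finite set of hyperplanes through the origin in $\mathbb R^d$, with face semigroup $\mathcal F$, intersection lattice $\mathcal L$ and face semigroup algebra $k\mathcal F$. For each $X\in\mathcal L$ fix a face $x\in\mathcal F$ with $\operatorname{supp}(x)=X$, and define elements $e_X\in k\mathcal F$ recursively by $e_X = x-\sum_{Y\in\mathcal L,\,Y>X} x\,e_Y$. Then $\{e_X\}_{X\in\mathcal L}$ is a complete system of primitive orthogonal idempotents in $k\mathcal F$.
   Context: For each $H\in\mathcal A$ fix a labelling $H^+,H^-$ of the two open half-spaces determined by $H$, and put $H^0=H$. A face of $\mathcal A$ is a nonempty set of the form $x=\bigcap_{H\in\mathcal A}H^{\sigma_H}$ with $\sigma_H\in\{+,-,0\}$; write $\sigma_H(x)=\sigma_H$. $\mathcal F$ is the set of faces. The support of a face is $\operatorname{supp}(x)=\bigcap_{H:\sigma_H(x)=0}H$ (equal to $\mathbb R^d$ if no $\sigma_H(x)$ is $0$). The intersection lattice $\mathcal L=\operatorname{supp}(\mathcal F)$ (equivalently, the set of intersections of subsets of $\mathcal A$) is ordered by inclusion; its top is $\hat 1=\mathbb R^d$ and its bottom is $\hat 0=\bigcap_{H\in\mathcal A}H$. The product $xy$ of faces is the face with $\sigma_H(xy)=\sigma_H(x)$ if $\sigma_H(x)\ne0$ and $\sigma_H(xy)=\sigma_H(y)$ if $\sigma_H(x)=0$. This makes $\mathcal F$ a semigroup with identity $1=\bigcap_{H\in\mathcal A}H$, and $k\mathcal F$ is its semigroup algebra over $k$. An idempotent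 $e$ in a $k$-algebra $A$ is primitive if it cannot be written $e=e_1+e_2$ with $e_1,e_2$ nonzero idempotents satisfying $e_1e_2=0=e_2e_1$. A family $\{e_i\}_{i\in I}$ is a complete system of primitive orthogonal idempotents if each $e_i$ is a primitive idempotent, $e_ie_j=0$ for $i\ne j$, and $\sum_i e_i=1$. *)

(* Defs.v *)
From HB Require Import structures.
From mathcomp Require Import all_boot all_order all_algebra finmap.
From mathcomp Require Import boolp classical_sets reals.
From mathcomp Require Import monalg.

Set Implicit Arguments.
Unset Strict Implicit.
Unset Printing Implicit Defensive.

Import Order.TTheory GRing.Theory Num.Theory.

Local Open Scope fset_scope.
Local Open Scope classical_set_scope.
Local Open Scope ring_scope.

(* [(\dim H).+1 = d] rather than [\dim H = d.-1]: there is no hyperplane in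
   dimension 0. *)
Record arrangement (R : realType) (d : nat) := Arrangement {
  hyps :> {fset {vspace 'rV[R]_d}};
  hypsP : forall H, H \in hyps -> (\dim H).+1 = d
}.

Definition open_half_spaces (R : realType) (d : nat)
    (H : {vspace 'rV[R]_d}) (P N : set 'rV[R]_d) :=
  exists2 phi : 'Hom('rV[R]_d, R^o), lker phi = H
    & P = [set v | 0 < phi v] /\ N = [set v | phi v < 0].

(* [half H true] is H^+ and [half H false] is H^-. *)
Record labelling (R : realType) (d : nat) (A : arrangement R d) := Labelling {
  half :> A -> bool -> set 'rV[R]_d;
  halfP : forall H : A, open_half_spaces (fsval H) (half H true) (half H false)
}.

Section Faces.
Context (R : realType) (d : nat) (A : arrangement R d) (l : labelling A).
Implicit Types (H : A) (u v : 'rV[R]_d).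

(* The signs +, -, 0 are [Some true], [Some false], [None]. *)
Definition signs := {ffun A -> option bool}.

Definition cell H (s : option bool) : set 'rV[R]_d :=
  if s is Some b then l H b else [set` fsval H].

Definition region (s : signs) : set 'rV[R]_d :=
  \bigcap_(H in [set: A]) cell H (s H).

Definition is_face (s : signs) : bool := `[< region s !=set0 >].

(* A face is represented by its sign vector; [face_region_inj] and
   [region_faceP] below state that [region] is a bijection from [face] to the
   nonempty sets of the form [region s]. *)
Record face := Face { sgn :> signs; sgnP : is_face sgn }.

HB.instance Definition _ := [isSub for sgn].
HB.instance Definition _ := [Finite of face by <:].

Lemma region_faceP (X : set 'rV[R]_d) :
  (exists x : face, region x = X) <->
  (X !=set0 /\ exists s : signs, X = region s).
Proof.
split=> [[x <-]|[X0 [s Xs]]].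
  by split; [exact/asboolP/(sgnP x) | exists (x : signs)].
have fs : is_face s by apply/asboolP; rewrite -Xs.
by exists (Face fs).
Qed.

Lemma cell_phi H : exists phi : 'Hom('rV[R]_d, R^o),
  forall v s, cell H s v <->
    s = (if phi v == 0 then None else Some (0 < phi v)).
Proof.
have [phi kphi [hP hN]] := halfP l H; exists phi => v s.
have vH : (v \in fsval H) = (phi v == 0) by rewrite -kphi memv_ker.
case: s => [[]|] /=; rewrite ?hP ?hN /= ?vH.
- case: ltgtP => //=.
- case: ltgtP => //=.
- by case: eqP.
Qed.

Lemma face_region_inj (x y : face) : region x = region y -> x = y.
Proof.
move=> xy; apply/val_inj/ffunP => H /=.
have /asboolP[v xv] := sgnP x.
have yv : region y v by rewrite -xy.
have [phi phiP] := cell_phi H.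
by rewrite ((phiP _ _).1 (xv H Logic.I)) ((phiP _ _).1 (yv H Logic.I)).
Qed.

Definition signs_mul (s t : signs) : signs :=
  [ffun H => if s H is Some b then Some b else t H].

Lemma cell_mul H u v :
  exists2 e : R, 0 < e & forall c, 0 < c -> c <= e ->
    forall s t, cell H s u -> cell H t v ->
    cell H (if s is Some b then Some b else t) (u + c *: v).
Proof.
have [phi phiP] := cell_phi H.
exists (if phi u == 0 then 1 else `|phi u| / (1 + `|phi v|)).
  case: eqP => // /eqP pu; apply: divr_gt0; first by rewrite normr_gt0.
  by rewrite ltr_wpDr.
move=> c c0 ce s t /phiP -> /phiP ->; apply/phiP.
rewrite linearD linearZ /=; move: ce.
have [->|pu] := eqVneq (phi u) 0 => ce /=.
  by rewrite add0r mulrI_eq0 ?pmulr_rgt0 //; apply/lregP; rewrite gt_eqF.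
have lt_cv : `|c * phi v| < `|phi u|.
  rewrite normrM (gtr0_norm c0).
  apply: (@lt_le_trans _ _ (c * (1 + `|phi v|))).
    by rewrite ltr_pM2l // ltrDr.
  by rewrite -ler_pdivlMr // ltr_wpDr.
move: lt_cv; rewrite /GRing.scale /=; set w := c * phi v => lt_w.
have [p|p|/eqP] := ltgtP (phi u) 0; last by rewrite (negbTE pu).
  have h : phi u + w < 0.
    by rewrite (ltr0_norm p) in lt_w; move: lt_w; rewrite ltr_norml opprK => /andP[_];
      rewrite -subr_gt0 -[_ < 0]oppr_gt0 opprD.
  by rewrite lt_eqF // ltNge (ltW h).
have h : 0 < phi u + w.
  by rewrite (gtr0_norm p) in lt_w; move: lt_w; rewrite ltr_norml => /andP[+ _];
    rewrite -subr_gt0 opprK addrC.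
by rewrite gt_eqF // h.
Qed.

Lemma is_face_mul (x y : face) : is_face (signs_mul x y).
Proof.
have /asboolP[u xu] := sgnP x; have /asboolP[v yv] := sgnP y.
suff [e e0 he] : exists2 e : R, 0 < e & forall H : A, H \in enum {: A} ->
    forall c, 0 < c -> c <= e -> cell H (signs_mul x y H) (u + c *: v).
  apply/asboolP; exists (u + e *: v) => H _.
  by apply: he; rewrite ?mem_enum.
elim: (enum _) => [|H r [e e0 he]]; first by exists 1.
have [e' e'0 he'] := cell_mul H u v.
exists (Order.min e e'); first by rewrite lt_min e0.
move=> K; rewrite inE => /orP[/eqP->|Kr] c c0; rewrite le_min => /andP[ce ce'].
  by rewrite ffunE; apply: he' => //; [exact: xu|exact: yv].
exact: he.
Qed.

Definition face_mul (x y : face) : face := Face (is_face_mul x y).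

Definition signs_one : signs := [ffun=> None].

Lemma is_face_one : is_face signs_one.
Proof. by apply/asboolP; exists 0 => H _; rewrite ffunE /= mem0v. Qed.

Definition face_one : face := Face is_face_one.

Lemma face_mulA : associative face_mul.
Proof.
by move=> x y z; apply/val_inj/ffunP => H /=; rewrite !ffunE; case: (sgn x H).
Qed.

Lemma face_mul1x : left_id face_one face_mul.
Proof. by move=> x; apply/val_inj/ffunP => H /=; rewrite !ffunE. Qed.

Lemma face_mulx1 : right_id face_one face_mul.
Proof.
by move=> x; apply/val_inj/ffunP => H /=; rewrite !ffunE; case: (sgn x H).
Qed.

Lemma face_unit (x y : face) :
  face_mul x y = face_one -> x = face_one /\ y = face_one.
Proof.
move=> /(congr1 sgn)/ffunP xy.
by split; apply/val_inj/ffunP => H; have := xy H; rewrite /= !ffunE;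
  case: (sgn x H).
Qed.

(* With this instance the face semigroup algebra over k is [{malg k[face]}],
   and the basis element of a face x is [<< x >>]. *)
HB.instance Definition _ := Choice_isMonomialDef.Build face
  face_mulA face_mul1x face_mulx1 face_unit.

Definition supp (x : face) : {vspace 'rV[R]_d} :=
  (\bigcap_(H : A | sgn x H == None) fsval H)%VS.

Definition lattice : {fset {vspace 'rV[R]_d}} := [fset supp x | x in {: face}].

Definition flat_lt (X Y : lattice) : bool :=
  (X != Y) && (fsval X <= fsval Y)%VS.

End Faces.

Section Idempotents.
Context (S : pzRingType).

Definition idempotent (e : S) := e * e = e.

Definition primitive_idempotent (e : S) :=
  idempotent e /\
  ~ exists e1 e2 : S, [/\ e = e1 + e2,
      idempotent e1 /\ idempotent e2, e1 != 0 /\ e2 != 0,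
      e1 * e2 = 0 & e2 * e1 = 0].

Definition complete_primitive_orthogonal_idempotents (I : finType)
    (e : I -> S) :=
  [/\ forall i, primitive_idempotent (e i),
      forall i j, i != j -> e i * e j = 0
    & \sum_i e i = 1].

End Idempotents.

(* Main.v *)
Require Import Defs.
From mathcomp Require Import all_boot all_order all_algebra finmap.
From mathcomp Require Import boolp classical_sets reals.
From mathcomp Require Import monalg.
From HB Require Import structures.

Set Implicit Arguments.
Unset Strict Implicit.
Unset Printing Implicit Defensive.

Import GRing.Theory.

Local Open Scope ring_scope.

(** In the face semigroup, [supp (u w)] is the join of [supp u] and [supp w],
    and [u w = u] as soon as [supp w <= supp u]; everything below follows from
    these two facts.

    Orthogonality.  Expanding the recursion at the flat of a face [u] gives
    [u = \sum_(Y >= supp u) u e_Y] ([face_sum]).  For [u = 1] this says that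
    the [e_Y] sum to 1.  For [u = w x_X] it is exactly what descending
    induction on [X] needs in order to get [w e_X = 0] whenever [supp w] is
    not below [X] ([face_mul_eq0]): among the terms [w x_X e_Y], [Y > X], of
    [w e_X], those with [Y] not above [supp (w x_X)] vanish by induction, and
    the others add up to [w x_X].  A second descending induction then yields
    [e_X e_Y = 0] for [X != Y] and [e_X e_X = e_X] ([e_mul]).

    Primitivity.  For each flat [Z] the linear map sending a face [w] to 1 if
    [supp w <= Z] and to 0 otherwise is multiplicative, and it takes the value
    1 on [e_Z] and 0 on the other [e_X] ([face_char_e]).  These characters
    detect idempotents: a nonzero idempotent has value 1 under at least one of
    them ([idempotent_char]).  The classical argument for this is that the
    kernel of the support map is nilpotent; here it is read off from the
    coefficient at a face of minimal support.  If [e_X = f + g] with [f], [g]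
    nonzero orthogonal idempotents, then [f e_X = f] and [g e_X = g], so only
    the character of [X] can be nonzero on [f] or [g]; it is therefore 1 on
    both, although [f g = 0]. *)

(** * Supports of faces *)

Section Supports.
Context (R : realType) (d : nat) (A : arrangement R d) (l : labelling A).
Implicit Types (u w z : face l) (X Y : lattice l).

(** A hyperplane containing [supp u] contains the nonempty region of [u],
    which forces the sign of [u] there to be 0; so the support determines the
    zero signs, and supports can be compared on sign vectors. *)
Lemma supp_leP u w :
  reflect (forall H : A, sgn w H = None -> sgn u H = None)
          (supp u <= supp w)%VS.
Proof.
apply: (iffP idP) => [uw H wH|uw].
  have /asboolP[v uv] := sgnP u.
  have vH : v \in fsval H.
    have: v \in supp w.
      apply: (subvP uw); rewrite /supp -[_ \in _]/(_ <= _)%VS.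
      by apply/subv_bigcapP => K /eqP uK; have := uv K Logic.I; rewrite uK.
    by apply/subvP/(@bigcapv_inf _ _ _ H); rewrite ?wH ?subvv.
  have [phi phiP] := cell_phi l H.
  have /phiP phi0 : cell l H None v by [].
  by rewrite ((phiP _ _).1 (uv H Logic.I)) -phi0.
apply/subv_bigcapP => H /eqP wH.
by apply: bigcapv_inf (subvv _); rewrite uw.
Qed.

Lemma face_mulE u w (H : A) :
  sgn (mmul u w) H = if sgn u H is Some b then Some b else sgn w H.
Proof. by rewrite /= ffunE. Qed.

(** The support of a product is the join of the supports, stated through its
    upper bounds so that no join operation on flats has to be introduced. *)
Lemma supp_mul_le u w z :
  (supp (mmul u w) <= supp z)%VS = (supp u <= supp z)%VS && (supp w <= supp z)%VS.
Proof.
apply/supp_leP/andP => [uwz|[/supp_leP uz /supp_leP wz] H zH].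
  by split; apply/supp_leP => H /uwz; rewrite face_mulE; case: (sgn u H).
by rewrite face_mulE uz // wz.
Qed.

Lemma supp_le_one w : (supp (mone : face l) <= supp w)%VS.
Proof. by apply/supp_leP => H _; rewrite /= ffunE. Qed.

Lemma mul_face_id u w : (supp w <= supp u)%VS -> mmul u w = u.
Proof.
move=> /supp_leP wu; apply/val_inj/ffunP => H /=; rewrite ffunE.
by case uH: (sgn u H) => //; apply: wu.
Qed.

Lemma supp_in_lattice u : supp u \in lattice l.
Proof. by apply/imfsetP; exists u. Qed.

Definition flat u : lattice l := [` supp_in_lattice u]%fset.

Lemma flat_dim_lt X Y : flat_lt X Y -> (\dim (fsval X) < \dim (fsval Y))%N.
Proof.
case/andP=> XY leXY; rewrite ltn_neqAle dimvS // andbT.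
apply: contra XY => /eqP eqd; apply/eqP/val_inj/eqP => /=.
by rewrite eqEdim leXY eqd leqnn.
Qed.

Lemma flat_lt_ind (P : lattice l -> Prop) :
  (forall X, (forall Y, flat_lt X Y -> P Y) -> P X) -> forall X, P X.
Proof.
move=> IH X; have [n] := ubnP (d - \dim (fsval X))%N.
elim: n X => // n IHn X; rewrite ltnS => leX; apply: IH => Y /flat_dim_lt ltXY.
apply: IHn; apply: leq_trans leX.
have: (\dim (fsval Y) <= d)%N.
  by rewrite (leq_trans (dimvS (subvf _))) // dimvf /dim /= mul1n.
by move=> leY; rewrite ltn_sub2l // (leq_trans ltXY).
Qed.

End Supports.

(** * Characters of the face semigroup algebra *)

Section Characters.
Context (k : fieldType) (R : realType) (d : nat) (A : arrangement R d).
Context (l : labelling A).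
Implicit Types (u w z : face l) (f g : {malg k[face l]}).

(** A flat is represented by any face [z] having it as support; this avoids a
    dependence on the chosen faces [x_X]. *)
Definition below z w : k := (supp w <= supp z)%VS%:R.

Lemma below_mmorphism z : mmorphism (below z).
Proof.
split; last by rewrite /below supp_le_one.
by move=> u w; rewrite /below supp_mul_le; do 2 case: (_ <= _)%VS;
  rewrite ?mulr1 ?mulr0.
Qed.

HB.instance Definition _ z :=
  isMultiplicative.Build (face l) k (below z) (below_mmorphism z).

Definition face_char z : {malg k[face l]} -> k := mmap idfun (below z).

Lemma face_charU z w : face_char z << w >> = (supp w <= supp z)%VS%:R.
Proof. by rewrite /face_char mmapU mul1r. Qed.

Lemma face_charM z f g : face_char z (f * g) = face_char z f * face_char z g.
Proof. exact: (rmorphM (mmap idfun (below z))). Qed.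

Lemma face_char_eq0 z w f :
  << w >> * f = f -> ~~ (supp w <= supp z)%VS -> face_char z f = 0.
Proof. by move=> <- /negPf wz; rewrite face_charM face_charU wz mul0r. Qed.

Lemma face_charB z f g : face_char z (f - g) = face_char z f - face_char z g.
Proof. exact: (rmorphB (mmap idfun (below z))). Qed.

Lemma face_char_sum z (I : finType) (P : pred I) (F : I -> {malg k[face l]}) :
  face_char z (\sum_(i | P i) F i) = \sum_(i | P i) face_char z (F i).
Proof. exact: (rmorph_sum (mmap idfun (below z))). Qed.

Lemma face_char0 z : face_char z 0 = 0.
Proof. exact: (rmorph0 (mmap idfun (below z))). Qed.

Lemma malgUM u w : << u >> * << w >> = << mmul u w >> :> {malg k[face l]}.
Proof. by rewrite [LHS]fgmulUU mulr1. Qed.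

(** Let [u] have support of minimal dimension among faces with [f@_u != 0].  If
    [a b = u] with [a], [b] in the support of [f], then [supp a <= supp u]
    and, by minimality, the two are equal; also [supp b <= supp u = supp a],
    so [u = a b = a].  Comparing coefficients at [u] in [f = f f] therefore
    gives [f@_u = f@_u * face_char u f]. *)
Lemma idempotent_char f :
  Defs.idempotent f -> f != 0 -> exists z, face_char z f = 1.
Proof.
move=> ff f0; have [u0 fu0] : exists u, f@_u != 0.
  apply/existsP; apply: contraNT f0; rewrite negb_exists => /forallP f0.
  by apply/eqP/malgP => u; rewrite mcoeff0; apply/eqP/negbNE/f0.
have [u fu min_u] :=
  @arg_minnP _ u0 (fun u => f@_u != 0) (fun u => \dim (supp u)) fu0.
exists u; apply: (mulfI fu); rewrite mulr1 -{3}ff.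
rewrite (mcoeffMlw _ (fsubset_refl _) (fsubset_refl _)).
rewrite (big_fsetD1 u) -?mcoeff_neq0 //= [X in _ + X]big1_seq ?addr0.
  rewrite /face_char mmapE mulr_sumr; apply: eq_bigr => w _ /=.
  rewrite /below mulrA mulr_natr; congr (_ *+ nat_of_bool _).
  apply/idP/eqP => [/mul_face_id //|uw].
  by have := subvv (supp u); rewrite -{1}uw supp_mul_le => /andP[].
move=> a /=; rewrite in_fsetD1 => /andP[au fa].
rewrite big1_seq // => b /= fb; case: eqP => // abu; case/negP: au.
move: (subvv (supp u)); rewrite -{1}abu supp_mul_le => /andP[au bu].
have /eqP supp_a : supp a == supp u.
  by rewrite eqEdim au min_u ?mcoeff_neq0.
by rewrite -abu mul_face_id // supp_a.
Qed.

End Characters.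

(** * The idempotents defined by the recursion *)

(** The next two lemmas carry out the manipulations of the recursion in an
    arbitrary ring, where unification cannot unfold the product of the
    semigroup algebra. *)
Lemma mulr_sub_sum (T : pzRingType) (I : finType) (P : pred I) (F : I -> T)
    (a b : T) :
  a * (b - \sum_(i | P i) b * F i) = a * b - \sum_(i | P i) a * b * F i.
Proof.
by rewrite mulrBr mulr_sumr; under eq_bigr do rewrite mulrA.
Qed.

Lemma mulr_sum_delta (T : pzRingType) (I : finType) (P : pred I) (F : I -> T)
    (a c : T) (j : I) :
  (forall i, P i -> F i * c = if i == j then c else 0) ->
  (\sum_(i | P i) a * F i) * c = if P j then a * c else 0.
Proof.
move=> Fc; rewrite mulr_suml; case: ifP => Pj.
  rewrite (bigD1 j) //= -mulrA Fc // eqxx big1 ?addr0 // => i /andP[Pi ij].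
  by rewrite -mulrA Fc // (negPf ij) mulr0.
rewrite big1 // => i Pi; rewrite -mulrA Fc //; case: eqP => [ij|_].
  by rewrite -ij Pi in Pj.
by rewrite mulr0.
Qed.

Section Recursion.
Context (k : fieldType) (R : realType) (d : nat) (A : arrangement R d).
Context (l : labelling A) (x : lattice l -> face l).
Context (x_supp : forall X : lattice l, supp (x X) = fsval X).
Context (e : lattice l -> {malg k[face l]}).
Context (e_rec : forall X : lattice l,
  e X = << x X >> - \sum_(Y : lattice l | flat_lt X Y) << x X >> * e Y).
Implicit Types (X Y Z : lattice l) (u w : face l).

(** Since [u x_U = u] for [U = supp u], multiplying the recursion for [e_U] on
    the left by [u] isolates [u]. *)
Lemma face_sum u :
  << u >> = \sum_(Y | (supp u <= fsval Y)%VS) << u >> * e Y.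
Proof.
have e_flat : << u >> * e (flat u) =
    << u >> - \sum_(Y | flat_lt (flat u) Y) << u >> * e Y.
  by rewrite e_rec mulr_sub_sum malgUM mul_face_id // x_supp.
rewrite (bigD1 (flat u)) // e_flat.
rewrite [X in _ = _ + X](eq_bigl (flat_lt (flat u))) ?subrK // => Y.
by rewrite /flat_lt andbC eq_sym.
Qed.

(** Expand [w e_X] by the recursion and the leading term [w x_X] by
    [face_sum]: both sums run over the same flats once the terms that vanish
    by induction are removed. *)
Lemma face_mul_eq0 X w : ~~ (supp w <= fsval X)%VS -> << w >> * e X = 0.
Proof.
elim/flat_lt_ind: X w => X IH w wX; rewrite e_rec mulr_sub_sum malgUM.
apply/eqP; rewrite {1}face_sum subr_eq0; apply/eqP.
(* Strictly above [X]: such a [Y] is above [supp w], and [X] is not. *)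
have lt_flat Y : (supp (mmul w (x X)) <= fsval Y)%VS -> flat_lt X Y.
  rewrite -x_supp supp_mul_le !x_supp => /andP[wY XY].
  by rewrite /flat_lt XY andbT; apply: contraNneq wX => ->.
rewrite [RHS](bigID (fun Y => supp (mmul w (x X)) <= fsval Y)%VS) /=.
rewrite [X in _ = _ + X]big1 ?addr0 => [|Y /andP[XY wxY]]; last exact: IH.
by apply: eq_bigl => Y; case: (boolP (_ <= _)%VS) => [/lt_flat ->|]; rewrite ?andbF.
Qed.

Lemma face_mul_e X : << x X >> * e X = e X.
Proof.
by rewrite e_rec mulr_sub_sum malgUM mul_face_id.
Qed.

(** Expanding [e_X] on the left leaves [x_X e_Y] minus at most one surviving
    term, which is again [x_X e_Y] and occurs when [X < Y].  Without it,
    [x_X e_Y] is [e_X] if [X = Y] and vanishes by [face_mul_eq0] otherwise. *)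
Lemma e_mul X Y : e X * e Y = if X == Y then e Y else 0.
Proof.
elim/flat_lt_ind: X => X IH; rewrite {1}e_rec mulrBl (mulr_sum_delta _ IH).
have [<-|neqXY] := eqVneq X Y.
  by rewrite /flat_lt eqxx subr0 face_mul_e.
rewrite /flat_lt neqXY /=; case: ifP => XY; first by rewrite subrr.
by rewrite face_mul_eq0 ?subr0 // x_supp XY.
Qed.

(** The recursion gives the value 1 at [X = Y], because [e_W = x_W e_W] and
    [x_W] is killed for [W > Y].  The value 0 for [X != Y] then follows by
    applying the character to [e_X e_Y = 0]. *)
Lemma face_char_e X Y : face_char (x Y) (e X) = (X == Y)%:R :> k.
Proof.
have char_diag Z : face_char (x Z) (e Z) = 1 :> k.
  rewrite e_rec face_charB face_char_sum face_charU subvv big1 ?subr0 // => W.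
  case/andP=> ZnW ZleW; rewrite face_charM (face_char_eq0 (face_mul_e W)).
    by rewrite mulr0.
  rewrite !x_supp; apply: contraNN ZnW => WleZ; apply/eqP/val_inj/eqP.
  by rewrite /= eqEsubv ZleW.
have [->|/negPf nXY] := eqVneq X Y; first exact: char_diag.
by rewrite -[LHS]mulr1 -(char_diag Y) -face_charM e_mul nXY face_char0.
Qed.

Lemma e_primitive X : primitive_idempotent (e X).
Proof.
split=> [|[f [g [def_e [ff gg] [f0 g0] fg gf]]]].
  by rewrite /Defs.idempotent e_mul eqxx.
have char_at_X h : h * e X = h -> Defs.idempotent h -> h != 0 ->
    face_char (x X) h = 1.
  move=> hX hh /(idempotent_char hh)[z hz].
  (* A character depends only on the support of the face indexing it. *)
  have zE : face_char z h = face_char (x (flat z)) h.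
    by rewrite /face_char !mmapE; apply: eq_bigr => w _; rewrite /below x_supp.
  move: hz; rewrite zE -{1}hX face_charM face_char_e.
  case: eqP => [<-|_]; first by rewrite mulr1.
  by rewrite mulr0 => /esym/eqP; rewrite oner_eq0.
have feX : f * e X = f by rewrite def_e mulrDr ff fg addr0.
have geX : g * e X = g by rewrite def_e mulrDr gg gf add0r.
have fX := char_at_X f feX ff f0; have gX := char_at_X g geX gg g0.
have /eqP := congr1 (face_char (x X)) fg.
by rewrite face_charM fX gX mulr1 face_char0 oner_eq0.
Qed.

End Recursion.

Theorem theorem5p2 (k : fieldType) (R : realType) (d : nat)
    (A : arrangement R d) (l : labelling A)
    (x : lattice l -> face l)
    (x_supp : forall X : lattice l, supp (x X) = fsval X)
    (e : lattice l -> {malg k[face l]})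
    (e_rec : forall X : lattice l,
       e X = << x X >> - \sum_(Y : lattice l | flat_lt X Y) << x X >> * e Y) :
  complete_primitive_orthogonal_idempotents e.
Proof.
split=> [X|X Y nXY|]; first exact: e_primitive.
  by rewrite (e_mul x_supp e_rec) (negPf nXY).
rewrite [RHS](face_sum x_supp e_rec (mone : face l)).
by apply: eq_big => Y; rewrite ?mul1r // -x_supp supp_le_one.
Qed.
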